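(* Let $(x_n)$ be a symmetric basis of a Banach space $X$. Then $$E(X,(x_n))\sim_B[0,1]^{\mathbb{N}}/\mathrm{coef}(X,(x_n)).$$
   Context: Banach spaces are real and $\mathbb{N}=\{0,1,2,\dots\}$. ''Basis'' means Schauder basis: every $x\in X$ has a unique expansion $x=\sum_n a(n)x_n$ with $a\in\mathbb{R}^{\mathbb{N}}$. For a sequence $(x_n)$ in a Banach space $X$, $\mathrm{coef}(X,(x_n))=\{a\in\mathbb{R}^{\mathbb{N}}:\sum_n a(n)x_n\text{ converges in }X\}$. Two sequences $(x_n),(y_n)$ in $X$ are equivalent if $\mathrm{coef}(X,(x_n))=\mathrm{coef}(X,(y_n))$. A basis $(x_n)$ is symmetric if for every permutation $\pi:\mathbb{N}\to\mathbb{N}$, $(x_{\pi(n)})$ is equivalent to $(x_n)$. $E(X,(x_n))$ is the equivalence relation on $\mathbb{R}^{\mathbb{N}}$ given by $(a,b)\in E(X,(x_n))\iff a-b\in\mathrm{coef}(X,(x_n))$, and $[0,1]^{\mathbb{N}}/\mathrm{coef}(X,(x_n))$ is its restriction to $[0,1]^{\mathbb{N}}$. For equivalence relations $E,F$ on Polish spaces $Z,W$, $E\le_B F$ means there is a Borel function $\theta:Z\to W$ with $(x,y)\in E\iff(\theta(x),\theta(y))\in F$ for all $x,y\in Z$; $E\sim_B F$ means $E\le_B F$ and $F\le_B E$. *)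

(* Defs.v *)
From HB Require Import structures.
From mathcomp Require Import all_boot all_order all_algebra.
From mathcomp Require Import all_classical all_reals all_analysis.

Set Implicit Arguments.
Unset Strict Implicit.
Unset Printing Implicit Defensive.

Import Order.TTheory GRing.Theory Num.Theory.
Import numFieldNormedType.Exports.

Local Open Scope classical_set_scope.
Local Open Scope ring_scope.

Definition RN (R : realType) : topologicalType :=
  prod_topology (fun _ : nat => R : topologicalType).

Definition hilbert_cube (R : realType) : set (RN R) :=
  [set a | forall n, 0 <= a n <= 1].

Arguments hilbert_cube R : clear implicits.

Section SchauderBases.
Variables (R : realType) (X : completeNormedModType R).
Implicit Types (x y : nat -> X) (a b : nat -> R).

Definition schauder_basis x : Prop :=
  forall v : X, exists! a, series (fun n => a n *: x n) @ \oo --> v.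

Definition coef x : set (nat -> R) :=
  [set a | cvgn (series (fun n => a n *: x n))].

Definition equivalent_seq x y : Prop := coef x = coef y.

Definition symmetric_basis x : Prop :=
  schauder_basis x /\
  forall p : nat -> nat, bijective p -> equivalent_seq (x \o p) x.

Definition E_rel x (a b : RN R) : Prop := coef x (fun n => a n - b n).

(* The coercion of [hilbert_cube] to a type is the subtype [set_type], which
   the library endows with the subspace topology. *)
Definition E_cube x (a b : hilbert_cube R) : Prop :=
  E_rel x (set_val a) (set_val b).

End SchauderBases.

Section BorelReducibility.

(* [<<s @open T >>] is the Borel sigma-algebra of [T]. *)
Definition borel_fun (Z W : topologicalType) (f : Z -> W) : Prop :=
  forall B : set W, <<s @open W >> B -> <<s @open Z >> (f @^-1` B).

(* Normally considered for equivalence relations on Polish spaces; neither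
   property enters the definition itself. *)
Definition borel_le (Z W : topologicalType)
    (E : Z -> Z -> Prop) (F : W -> W -> Prop) : Prop :=
  exists2 f : Z -> W, borel_fun f & forall a b, E a b <-> F (f a) (f b).

Definition borel_bireducible (Z W : topologicalType)
    (E : Z -> Z -> Prop) (F : W -> W -> Prop) : Prop :=
  borel_le E F /\ borel_le F E.

End BorelReducibility.

(* Main.v *)
Require Import Defs.
From HB Require Import structures.
From mathcomp Require Import all_boot all_order all_algebra.
From mathcomp Require Import all_classical all_reals all_analysis.
From mathcomp Require Import ring lra.

(** One reduction is the inclusion of the cube. For the other one, each real
    [a n] is replaced by its slices [clip (a n - k)], [k] ranging over the
    integers, where [clip] truncates to the unit interval. Let [d] be a
    difference [a - b] and [D] the corresponding family of differences of slices,
    listed as a sequence; it has to be shown that [d] is in [coef x] exactly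
    when [D] is. If [d] is bounded by an integer [L], then for every [n] only the
    [L + 1] slices starting at the integer part of [Num.min (a n) (b n)] can
    differ; each of their differences is a multiple of [d n] by a factor in the
    unit interval, and their sum is [d n]. So [D] is a sum of [L + 1] sequences
    supported on disjoint sets, each obtained from [d] by such multipliers and by
    moving the entries along an injection ([slice_multiplier], [sum_slices],
    [slices_decomposition]). It therefore suffices that, for a symmetric basis,

    - [coef x] is stable under multipliers in the unit interval ([coef_solid]);
    - moving entries along an injection of the natural numbers does not affect
      membership in [coef x] ([coef_spread]), and selecting entries along one
      preserves it ([coef_comp_inj]);
    - elements of [coef x] tend to zero ([coef_null]).

    The last item supplies the bound [L]: from [d] itself in one direction, and
    in the other one because slices one level above the integer part differ by
    one when [a n] and [b n] are at distance at least two ([slot1_jump]).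

    Symmetry is assumed in the form that the series of the [a n *: x n] and of
    the [a n *: x (p n)] converge together, and says nothing about their sums. The
    bridge is the continuity of the coordinate functionals
    ([coordinate_bound]): it identifies the coordinates of the sum of a series
    along [x \o p], so that [coef x] is stable under permutation of the entries
    ([coef_perm]) and convergence is unconditional ([cvg_rearranged]).
    Unconditional convergence gives uniformly small subsums of the tails by a
    gliding hump ([coef_subsum_small]), hence [coef_solid] by convexity. A
    sequence vanishing on an infinite set can be moved along an injection by a
    permutation, so splitting into even and odd entries yields [coef_spread]. *)

Set Implicit Arguments.
Unset Strict Implicit.
Unset Printing Implicit Defensive.

Import Order.TTheory GRing.Theory Num.Theory.
Import numFieldNormedType.Exports.

Local Open Scope classical_set_scope.
Local Open Scope ring_scope.

(** * Convergent sequences *)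

Section Sequences.
Variables (R : realType) (V : normedModType R).

Lemma cvg_seqP (u : nat -> V) (l : V) :
  u @ \oo --> l <->
  forall e, 0 < e -> exists N, forall n, (N <= n)%N -> `|u n - l| < e.
Proof.
split=> [/cvgrPdistC_lt ul e /ul[N _ HN]|H]; first by exists N => n /HN.
by apply/cvgrPdistC_lt => e /H[N HN]; exists N.
Qed.

End Sequences.

Lemma cvgn_cauchyP (R : realType) (V : completeNormedModType R) (u : nat -> V) :
  cvgn u <->
  forall e, 0 < e -> exists N, forall n, (N <= n)%N -> `|u n - u N| < e.
Proof.
split=> [/cvg_ex[l /cvg_seqP ul] e e0|H].
  have [|N HN] := ul (e / 2); first by rewrite divr_gt0.
  exists N => n Nn; rewrite -(subrKA l (u n)) [ltRHS]splitr.
  by rewrite (le_lt_trans (ler_normD _ _))// ltrD// ?HN// distrC HN.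
apply/cauchy_cvgP/cauchy_exP => e /H[N HN]; exists (u N), N => // n Nn.
by rewrite -ball_normE /= distrC HN.
Qed.

(** * Coordinates along a Schauder basis *)

Section Coordinates.
Variables (R : realType) (X : completeNormedModType R) (x : nat -> X).
Hypothesis bx : schauder_basis x.

Local Notation S a := (series (fun n => a n *: x n)).

Lemma psumD a b N : S (fun n => a n + b n) N = S a N + S b N.
Proof.
by rewrite /series /= -big_split /=; apply: eq_bigr => i _; rewrite scalerDl.
Qed.

Lemma psumZ c a N : S (fun n => c * a n) N = c *: S a N.
Proof.
by rewrite /series /= scaler_sumr; apply: eq_bigr => i _; rewrite scalerA.
Qed.

Lemma psumB a b N : S (fun n => a n - b n) N = S a N - S b N.
Proof.
by rewrite /series /= -sumrB; apply: eq_bigr => i _; rewrite scalerBl.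
Qed.

Lemma psumS a N : S a N.+1 = S a N + a N *: x N.
Proof. by rewrite /series /= big_nat_recr. Qed.

Lemma expansion_unique a b (v : X) : S a @ \oo --> v -> S b @ \oo --> v -> a = b.
Proof. by have [c [_ cu]] := bx v; move=> /cu <- /cu <-. Qed.

Lemma basis_neq0 n : x n != 0.
Proof.
apply/eqP => xn0.
have H a : (forall k, a k *: x k = 0) -> S a @ \oo --> (0 : X).
  move=> a0; apply/cvg_seqP => e e0; exists 0%N => N _.
  by rewrite /series /= big1 ?subrr ?normr0.
have e0 k : (k == n)%:R *: x k = 0.
  by case: eqP => [->|_]; rewrite ?xn0 ?scaler0 ?scale0r.
have := expansion_unique (H _ e0) (H (fun=> 0) (fun k => scale0r (x k))).
by move=> /(congr1 (fun a => a n))/eqP; rewrite eqxx oner_eq0.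
Qed.

(** A Baire category argument. The vectors whose expansion has partial sums
    bounded by some [M] exhaust the space as [M] grows, so for one [M] they are
    dense in a ball; differences of two of them are dense in a ball around the
    origin, and homogeneity adapts the radius. *)
Lemma approx_expansion : exists2 K, 0 < K & forall s u d,
  `|u| < s -> 0 < d -> exists aw : (nat -> R) * X,
  [/\ S aw.1 @ \oo --> aw.2, forall N, `|S aw.1 N| <= K * s & `|u - aw.2| < d].
Proof.
pose B (M : nat) : set X :=
  [set w | exists2 a, S a @ \oo --> w & forall N, `|S a N| <= M%:R].
have [M [v [r r0 ballB]]] : exists M v, exists2 r, 0 < r &
    forall u, `|u| < r -> closure (B M) (v + u).
  apply: contrapT => nB.
  have : dense (\bigcap_M (~` closure (B M))).
    apply: Baire => M; split; first exact/closed_openC/closed_closure.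
    move=> O [v Ov] oO; apply: contrapT => O0; apply: nB.
    have /nbhs_ballP[r /= r0 rO] := open_nbhs_nbhs (conj oO Ov).
    exists M, v, r => // u ur; apply: contrapT => nBu; apply: O0.
    exists (v + u); split=> //; apply: rO.
    by rewrite -ball_normE /= opprD addNKr normrN.
  move=> /(_ setT) [||w [_ Hw]]; [by exists 0|exact: openT|].
  have [a [Saw _]] := bx w.
  have /cvg_seq_bounded[m [_ /(_ (m + 1))]] := cvgP _ Saw.
  rewrite ltrDl ltr01 => /(_ isT) bm.
  have [k mk] : exists k : nat, m + 1 <= k%:R.
    by exists (Num.truncn (m + 1)).+1; rewrite ltW// truncnS_gt.
  (* Convergent partial sums are bounded, so [w] is in [B k]. *)
  apply: (Hw k I); apply: subset_closure; exists a => // N.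
  by rewrite (le_trans _ mk)// bm.
exists (2 * M.+1%:R / r); first by rewrite divr_gt0// mulr_gt0.
move=> s u d us d0; have s0 : 0 < s by rewrite (le_lt_trans _ us).
pose q := s / r; have q0 : 0 < q by rewrite divr_gt0.
have approx z : `|z| < r -> exists aw : (nat -> R) * X,
    [/\ S aw.1 @ \oo --> aw.2, forall N, `|S aw.1 N| <= M%:R &
        `|v + z - aw.2| < d / q / 2].
  have e0 : 0 < d / q / 2 by rewrite !divr_gt0.
  move=> /ballB cz; have [w [[a aw aM]]] := cz _ (nbhsx_ballx (v + z) _ e0).
  by rewrite -ball_normE /= => Hw; exists (a, w).
have [|[a1 w1] /= [aw1 aM1 H1]] := approx (q^-1 *: u).
  rewrite normrZ gtr0_norm ?invr_gt0// mulrC ltr_pdivrMr// mulrC divfK//.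
  by rewrite gt_eqF.
have [|[a2 w2] /= [aw2 aM2 H2]] := approx 0; first by rewrite normr0.
exists (fun n => q * (a1 n - a2 n), q *: (w1 - w2)) => /=; split.
- have -> : S (fun n => q * (a1 n - a2 n)) = fun N => q *: (S a1 N - S a2 N).
    by apply/funext => N; rewrite psumZ psumB.
  by apply: cvgZ; [exact: cvg_cst | exact: cvgB].
- move=> N; rewrite psumZ psumB normrZ gtr0_norm//.
  rewrite (_ : _ * s = q * (2 * M.+1%:R)); last by rewrite /q; ring.
  rewrite ler_pM2l//.
  rewrite (le_trans (ler_normB _ _))// mulr2n mulrDl mul1r//.
  by rewrite lerD// ?(le_trans (aM1 N)) ?(le_trans (aM2 N))// ler_nat.
- have -> : u - q *: (w1 - w2) =
      q *: ((v + q^-1 *: u - w1) - (v + 0 - w2)).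
    have -> z : v + z - w1 - (v + 0 - w2) = z - (w1 - w2).
      rewrite addr0 (addrC v) -!addrA; congr (_ + _).
      by rewrite !opprB addrC !addrA subrK addrC.
    by rewrite [RHS]scalerBr scalerA divff ?gt_eqF// scale1r.
  rewrite normrZ gtr0_norm// mulrC -ltr_pdivlMr//.
  by rewrite (le_lt_trans (ler_normB _ _))// [ltRHS]splitr ltrD.
Qed.

(** The completeness half of the open mapping theorem. Approximating [u], then
    the remainder, and so on with halved radii gives coefficient sequences whose
    partial sums have geometrically small norms; their sum is an expansion of
    [u] with controlled partial sums. *)
Lemma bounded_expansion : exists2 K, 0 < K & forall s u,
  `|u| < s -> exists2 a, S a @ \oo --> u & forall N, `|S a N| <= K * s.
Proof.
have [K K0 approx] := approx_expansion; exists (2 * K); first exact: mulr_gt0.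
move=> s u us; have s0 : 0 < s by rewrite (le_lt_trans _ us).
have /choice[f Pf] : forall us : X * R, exists aw : (nat -> R) * X,
    `|us.1| < us.2 ->
    [/\ S aw.1 @ \oo --> aw.2, forall N, `|S aw.1 N| <= K * us.2 &
        `|us.1 - aw.2| < us.2 / 2].
  move=> [u' s']; have [lt_us|] := boolP (`|u'| < s'); last first.
    by move=> ?; exists (fun=> 0, 0).
  have [|aw Paw] := approx s' u' (s' / 2) lt_us; last by exists aw.
  by rewrite divr_gt0// (le_lt_trans _ lt_us).
pose t j := s * 2^-1 ^+ j.
have t0 j : 0 < t j by rewrite mulr_gt0// exprn_gt0// invr_gt0.
have tS j : t j.+1 = t j / 2 by rewrite /t exprSr mulrA.
pose fix rem j := if j is i.+1 then rem i - (f (rem i, t i)).2 else u.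
pose c j := (f (rem j, t j)).1.
have remt j : `|rem j| < t j.
  elim: j => [|j IHj]; first by rewrite /t expr0 mulr1.
  by have [_ _] := Pf (rem j, t j) IHj; rewrite tS.
pose b J n := \sum_(0 <= j < J) c j n.
have SbS J N : S (b J.+1) N = S (b J) N + S (c J) N.
  by rewrite -psumD; congr (series _ N); apply/funext => n; rewrite /b big_nat_recr.
have Sb0 N : S (b 0%N) N = 0.
  by rewrite /series /= big1// => i _; rewrite /b big_geq// scale0r.
have Sb J : S (b J) @ \oo --> u - rem J.
  elim: J => [|J IHJ].
    by rewrite subrr (_ : S _ = cst 0); [exact: cvg_cst|apply/funext].
  have -> : S (b J.+1) = S (b J) \+ S (c J) by apply/funext => N; exact: SbS.
  have [Sc _ _] := Pf (rem J, t J) (remt J).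
  by rewrite /= opprB addrA addrAC; exact: cvgD.
(* The sum of the [K * t j] telescopes, as [t j = 2 * (t j - t j.+1)]. *)
have tailS J i N : `|S (b (J + i)%N) N - S (b J) N| <= 2 * K * (t J - t (J + i)%N).
  elim: i => [|i IHi]; first by rewrite addn0 !subrr normr0 mulr0.
  rewrite addnS SbS addrAC (le_trans (ler_normD _ _))//.
  have [_ /(_ N) /= /(lerD IHi) cN _] := Pf (rem (J + i)%N, t (J + i)%N) (remt _).
  by rewrite (le_trans cN)// tS; lra.
have tail J J' N : (J <= J')%N -> `|S (b J') N - S (b J) N| <= 2 * K * t J.
  move=> /subnKC <-; rewrite (le_trans (tailS _ _ _))//.
  by rewrite ler_pM2l ?mulr_gt0// gerBl ltW.
have tsmall e : 0 < e -> exists J, t J < e.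
  have /cvgrPdistC_lt ht := @cvg_geometric R s 2^-1 ltac:(by
    rewrite gtr0_norm ?invr_gt0// invf_lt1// ltr1n).
  move=> /ht[J _ /(_ J (leqnn J))]; rewrite subr0 /= gtr0_norm; last exact: t0.
  by exists J.
have bcvg n : cvgn (b^~ n : nat -> R^o).
  apply/cvgn_cauchyP => e e0; have x0 : 0 < `|x n| by rewrite normr_gt0 basis_neq0.
  have [|J tJ] := tsmall (e * `|x n| / (4 * K)); first by rewrite divr_gt0 ?mulr_gt0.
  exists J => J' JJ'; rewrite -(ltr_pM2r x0) -normrZ.
  (* A single term is the difference of two consecutive partial sums. *)
  have -> : (b J' n - b J n) *: x n =
      (S (b J') n.+1 - S (b J) n.+1) - (S (b J') n - S (b J) n).
    by rewrite -!psumB psumS [RHS]addrAC subrr add0r.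
  rewrite (le_lt_trans (ler_normB _ _))// (le_lt_trans (lerD (tail _ _ _ JJ') (tail _ _ _ JJ')))//.
  by move: tJ; rewrite ltr_pdivlMr ?mulr_gt0//; lra.
pose a n : R := lim (b^~ n @ \oo).
(* [S] involves finitely many coordinates at a time. *)
have Sacvg N : (fun J => S (b J) N) @ \oo --> S a N.
  elim: N => [|N IHN].
    rewrite (_ : (fun _ => _) = cst (S a 0%N)); first exact: cvg_cst.
    by apply/funext => J; rewrite /series /= !big_geq.
  rewrite psumS; under eq_fun do rewrite psumS.
  by apply: cvgD => //; apply: cvgZ; [exact: bcvg | exact: cvg_cst].
have tailS_lim J N : `|S a N - S (b J) N| <= 2 * K * t J.
  apply/ler_addgt0Pr => e e0; have /cvg_seqP/(_ _ e0)[J' HJ'] := Sacvg N.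
  rewrite -(subrKA (S (b (maxn J J')) N)) addrC (le_trans (ler_normD _ _))//.
  by rewrite lerD ?tail ?leq_maxl// distrC ltW// HJ'// leq_maxr.
exists a.
  apply/cvg_seqP => e e0.
  have [|J tJ] := tsmall (e / 2 / (2 * K + 1)).
    by rewrite !divr_gt0// addr_gt0// mulr_gt0.
  have /cvg_seqP/(_ (e / 2))[|N HN] := Sb J; first by rewrite divr_gt0.
  exists N => n /HN H; rewrite -(subrKA (S (b J) n)) (le_lt_trans (ler_normD _ _))//.
  have -> : S (b J) n - u = (S (b J) n - (u - rem J)) - rem J.
    by rewrite opprB addrA addrAC addrK.
  have := ler_normB (S (b J) n - (u - rem J)) (rem J).
  have := remt J; have := tailS_lim J n; move: tJ H.
  by rewrite ltr_pdivlMr ?addr_gt0 ?mulr_gt0//; lra.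
move=> N; have := tailS_lim 0%N N.
by rewrite Sb0 subr0 /t expr0 mulr1.
Qed.

(** Continuity of the coordinate functionals: since expansions are unique, the
    controlled one of [bounded_expansion] is the given one. *)
Lemma coordinate_bound : exists2 K, 0 < K & forall s c (u : X) m,
  `|u| < s -> S c @ \oo --> u -> `|c m| * `|x m| <= K * s.
Proof.
have [K K0 bK] := bounded_expansion; exists (2 * K); first by rewrite mulr_gt0.
move=> s c u m us cu; have [a au aK] := bK s u us.
rewrite -(expansion_unique au cu) -normrZ -(addKr (S a m) (a m *: x m)) -psumS.
by rewrite (le_trans (ler_normD _ _))// normrN mulr2n !mulrDl mul1r lerD.
Qed.

End Coordinates.

(** * Transport of coefficients along an injection *)

Section Spread.
Variable R : realType.
Implicit Types (a : nat -> R) (i : nat -> nat).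

(** The push-forward of [a] along [i]; for a permutation [i] it is [a] composed
    with the inverse of [i]. *)
Definition spread i a : nat -> R := patch (fun=> 0) (range i) (a \o pinv setT i).

Lemma spreadE i a n : injective i -> spread i a (i n) = a n.
Proof.
move=> ii; rewrite /spread patchT /=; last by rewrite inE; exists n.
by rewrite pinvKV ?inE//; exact: in2W.
Qed.

Lemma spread_out i a m : (forall n, i n <> m) -> spread i a m = 0.
Proof. by move=> im; rewrite /spread patchC// inE => -[n _ /im]. Qed.

End Spread.

Section Rearrangement.
Variables (R : realType) (X : completeNormedModType R) (x : nat -> X).
Hypothesis bx : schauder_basis x.

Local Notation S a := (series (fun n => a n *: x n)).

Lemma coef_add a b : coef x a -> coef x b -> coef x (fun n => a n + b n).
Proof.
move=> ca cb; have -> : coef x (fun n => a n + b n) = cvgn (S a \+ S b).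
  by congr (cvgn _); apply/funext => N; exact: psumD.
exact: is_cvgD.
Qed.

Lemma psum_delta p N : (p < N)%N -> S (fun m => (m == p)%:R) N = x p.
Proof.
move=> pN; rewrite /series /= big_mkord (bigD1 (Ordinal pN))//= eqxx scale1r.
by rewrite big1 ?addr0// => k kp; rewrite (negbTE kp : (k : nat) == p = false) scale0r.
Qed.

(** The sum of [a k *: x (q k)] has an expansion along [x], and each of its
    coordinates is the limit of the coordinates of the partial sums, by
    continuity. Those coordinates are eventually the entries of [spread q a]. *)
Lemma coef_spread_of_cvg q a : injective q ->
  cvgn (series (fun k => a k *: x (q k))) -> coef x (spread q a).
Proof.
move=> iq /cvg_ex[/= v wv]; have [d [dv _]] := bx v.
suff -> : spread q a = d by apply/cvg_ex; exists v.
(* [e N] is the coordinate sequence of the partial sum of [N] terms. *)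
pose e N m := \sum_(0 <= k < N) a k * (m == q k)%:R.
have Se N : S (e N) @ \oo --> series (fun k => a k *: x (q k)) N.
  elim: N => [|N IHN].
    rewrite {2}/series /= big_geq// (_ : S (e 0%N) = cst 0); first exact: cvg_cst.
    by apply/funext => M; rewrite /series /= big1// => k _; rewrite /e big_geq// scale0r.
  rewrite {2}/series /= big_nat_recr//=.
  rewrite (_ : S (e N.+1) = S (e N) \+ (fun M => a N *: S (fun m => (m == q N)%:R) M)).
    apply: cvgD => //; apply: cvgZ; first exact: cvg_cst.
    apply/cvg_seqP => r r0; exists (q N).+1 => M qM.
    by rewrite psum_delta// subrr normr0.
  apply/funext => M; rewrite /= -psumZ -psumD; congr (series _ M).
  by apply/funext => m; rewrite /e big_nat_recr.
have eE m : exists N0, forall N, (N0 <= N)%N -> e N m = spread q a m.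
  have [[k <-]|nk] := pselect (exists k, q k = m); last first.
    exists 0%N => N _; rewrite spread_out; last by move=> k km; apply: nk; exists k.
    rewrite /e big1// => k _; case: eqP => [mk|_]; last by rewrite mulr0.
    by exfalso; apply: nk; exists k.
  exists k.+1 => N kN; rewrite spreadE// /e big_mkord (bigD1 (Ordinal kN))//= eqxx mulr1.
  rewrite big1 ?addr0// => j jk; rewrite (inj_eq iq) eq_sym.
  by rewrite (negbTE jk : (j : nat) == k = false) mulr0.
have [K K0 HK] := coordinate_bound bx.
apply/funext => m; apply/eqP; rewrite eq_sym -subr_eq0.
rewrite -[_ == _]orbF -(negbTE (basis_neq0 bx m)) -scaler_eq0 -normr_le0.
apply/ler_addgt0Pr => r r0; rewrite add0r normrZ.
have [|N1 HN1] := (cvg_seqP _ _).1 wv (r / K); first by rewrite divr_gt0.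
have [N0 HN0] := eE m; pose N := maxn N0 N1.
rewrite -(HN0 N (leq_maxl _ _)).
have := HK (r / K) (fun n => d n - e N n)
  (v - series (fun k => a k *: x (q k)) N) m.
rewrite distrC HN1 ?leq_maxr// (mulrC K) divfK ?gt_eqF//; apply=> //.
rewrite (_ : S (fun n => d n - e N n) = S d \- S (e N)); first exact: cvgB.
by apply/funext => M; exact: psumB.
Qed.

End Rearrangement.

(** * Two constructions of permutations of the natural numbers *)

Section BlockPermutation.
Variables (M : nat -> nat) (s : nat -> seq nat).
Hypotheses (M0 : M 0%N = 0%N) (Mlt : forall j, (M j < M j.+1)%N).
Hypothesis sM : forall j, perm_eq (s j) (index_iota (M j) (M j.+1)).

Lemma block_le j k : (j <= k)%N -> (M j <= M k)%N.
Proof.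
elim: k => [|k IHk]; first by rewrite leqn0 => /eqP->.
by rewrite leq_eqVlt => /predU1P[->//|/IHk /leq_trans->//]; exact: ltnW.
Qed.

Lemma block_uniq j k n : (M j <= n < M j.+1)%N -> (M k <= n < M k.+1)%N -> j = k.
Proof.
move=> /andP[jn nj] /andP[kn nk]; apply/eqP; rewrite eqn_leq.
apply/andP; split; rewrite leqNgt; apply/negP => /block_le.
  by rewrite leqNgt (leq_ltn_trans jn nk).
by rewrite leqNgt (leq_ltn_trans kn nj).
Qed.

(** The intervals [[M j, M j.+1)] tile the natural numbers, so [p] may act on
    each of them separately: it sends an element to the entry of [s j] found at
    the offset of that element from the left end. *)
Lemma block_permutation : exists2 p : nat -> nat, bijective p &
  forall j, map p (index_iota (M j) (M j.+1)) = s j.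
Proof.
have Mn n : exists j, (M j <= n < M j.+1)%N.
  elim: n => [|n [j /andP[jn nj]]].
    by exists 0%N; rewrite M0 leqnn -{1}M0 Mlt.
  have [nj'|jn'] := ltnP n.+1 (M j.+1).
    by exists j; rewrite nj' (leq_trans jn).
  by exists j.+1; rewrite jn' (leq_trans _ (Mlt _)).
have [b bP] := choice Mn.
have b_eq j n : (M j <= n < M j.+1)%N -> b n = j.
  by move=> jn; apply: block_uniq (bP n) jn.
have sz j : size (s j) = (M j.+1 - M j)%N by rewrite (perm_size (sM j)) size_iota.
have su j : uniq (s j) by rewrite (perm_uniq (sM j)) iota_uniq.
have sin j n : (n \in s j) = (M j <= n < M j.+1)%N.
  by rewrite (perm_mem (sM j)) mem_index_iota.
pose p n := nth 0%N (s (b n)) (n - M (b n))%N.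
have ltb n : (n - M (b n) < size (s (b n)))%N.
  by have /andP[bn nb] := bP n; rewrite sz ltn_sub2r// (leq_ltn_trans bn nb).
have bp n : b (p n) = b n by apply: b_eq; rewrite -sin mem_nth.
exists p.
  rewrite -setTT_bijective; split=> // [n n' _ _ pp|m _].
    have bb : b n = b n' by rewrite -(bp n) pp bp.
    have ltb' : (n - M (b n') < size (s (b n')))%N by rewrite -bb ltb.
    move/eqP: pp; rewrite /p bb nth_uniq// => /eqP /(congr1 (addn^~ (M (b n')))).
    have /andP[+ _] := bP n; have /andP[h' _] := bP n'.
    by rewrite bb => h; rewrite /= !subnK.
  have ms : m \in s (b m) by rewrite sin.
  exists (M (b m) + index m (s (b m)))%N => //.
  have bi : b (M (b m) + index m (s (b m)))%N = b m.
    apply: b_eq; rewrite leq_addr/= -ltn_subRL -sz index_mem//.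
  by rewrite /p bi addKn nth_index.
move=> j; apply: (@eq_from_nth _ 0%N); first by rewrite size_map size_iota sz.
move=> i; rewrite size_map => ij; rewrite (nth_map 0%N)//.
move: ij; rewrite size_iota => ij; rewrite nth_iota//.
have bi : b (M j + i)%N = j by apply: b_eq; rewrite leq_addr/= -ltn_subRL.
by rewrite /p bi addKn.
Qed.

End BlockPermutation.

Lemma infinite_image_inj (f : nat -> nat) : injective f -> infinite_set (range f).
Proof.
by move=> fi; apply/infiniteP; rewrite (card_le_eqr (inj_card_eq (in2W fi))).
Qed.

(** The left inverse of [i] on [i @` P] extends to a permutation because both
    the complement of [P] and the complement of [i @` P], which contains the
    image of the former, are countably infinite. *)
Lemma extend_partial_inverse (i : nat -> nat) (P : pred nat) : injective i ->
  infinite_set [set n | ~~ P n] -> exists2 p, bijective p &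
    (forall n, P n -> p (i n) = n) /\
    (forall m, (forall n, P n -> i n <> m) -> ~~ P (p m)).
Proof.
move=> ii infP; pose A := [set m | forall n, P n -> i n <> m].
have infA : infinite_set A.
  apply: (@sub_infinite_set _ (i @` [set n | ~~ P n])).
    by move=> _ [n /= nP <-] k kP /ii kn; rewrite -kn kP in nP.
  by apply/infiniteP; rewrite (card_le_eqr (inj_card_eq (in2W ii))); exact/infiniteP.
have : (A #= [set n | ~~ P n])%card.
  rewrite (card_eq_trans (eq_card_nat (countableP _) infA))// card_eq_sym.
  exact: eq_card_nat.
move=> /card_set_bijP[g [gP gi gs]].
have inA m : m \in A \/ exists2 n, P n & i n = m.
  have [mA|mA] := pselect (A m); [by left; rewrite inE|right].
  by apply: contrapT => nk; apply: mA => k Pk km; apply: nk; exists k.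
have iA n : P n -> (i n \in A) = false.
  by move=> Pn; apply: memNset => /(_ n Pn).
pose p m := if m \in A then g m else pinv setT i m.
have pi n : P n -> p (i n) = n.
  by move=> Pn; rewrite /p iA// pinvKV ?inE//; exact: in2W.
have pA m : m \in A -> p m = g m by rewrite /p => ->.
exists p; last first.
  by split=> // m mA; rewrite pA ?inE//; exact: gP.
rewrite -setTT_bijective; split=> // [m m' _ _|n _].
  have [mA|[n Pn <-]] := inA m; have [mA'|[n' Pn' <-]] := inA m'.
  - by rewrite !pA//; exact: gi.
  - by rewrite pA// pi// => gn; have := gP m (set_mem mA); rewrite /= gn Pn'.
  - by rewrite (pA _ mA') pi// => gn; have := gP m' (set_mem mA'); rewrite /= -gn Pn.
  - by rewrite !pi// => ->.
have [Pn|nP] := boolP (P n); first by exists (i n) => //; exact: pi.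
by have [m mA <-] := gs n nP; exists m => //; rewrite pA ?inE.
Qed.

(** * Multipliers in the unit interval *)

(** A point of the unit cube is a convex combination of vertices, so a bound on
    the norms of all subsums passes to multipliers in the unit interval. The
    free vector [v] lets the induction treat one multiplier at a time. *)
Lemma norm_convex_subsums (R : realType) (V : normedModType R) (y : nat -> V)
    (t : nat -> R) (e : R) m i :
  (forall k, 0 <= t k <= 1) -> forall v,
  (forall T : pred nat, `|v + \sum_(m <= k < m + i) (T k)%:R *: y k| <= e) ->
  `|v + \sum_(m <= k < m + i) t k *: y k| <= e.
Proof.
move=> t01; elim: i => [|i IHi] v He.
  by have := He xpredT; rewrite addn0 !big_geq.
rewrite addnS big_nat_recr ?leq_addr//=.
set A := \sum_(_ <= _ < _) _; set k := (m + i)%N; have /andP[tk0 tk1] := t01 k.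
have -> : v + (A + t k *: y k) = (1 - t k) *: (v + A) + t k *: (v + y k + A).
  rewrite [v + y k + A]addrAC [t k *: (v + A + _)]scalerDr [RHS]addrA -scalerDl subrK scale1r.
  by rewrite addrA.
rewrite (le_trans (ler_normD _ _))// !normrZ !ger0_norm ?subr_ge0//.
have sumT (c : bool) (T : pred nat) :
    \sum_(m <= k' < m + i) (if k' == k then c else T k')%:R *: y k' =
    \sum_(m <= k' < m + i) (T k')%:R *: y k'.
  by apply: eq_big_nat => k' /andP[_ k'k]; rewrite ltn_eqF.
(* Subsums without and with the last term, the latter absorbed into [v]. *)
have h0 : `|v + A| <= e.
  apply: IHi => T; have := He (fun k' => if k' == k then false else T k').
  by rewrite addnS big_nat_recr ?leq_addr//= sumT eqxx scale0r addr0.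
have h1 : `|v + y k + A| <= e.
  apply: IHi => T; have := He (fun k' => if k' == k then true else T k').
  by rewrite addnS big_nat_recr ?leq_addr//= sumT eqxx scale1r addrA addrAC.
nra.
Qed.

Definition cutoff (R : realType) (P : pred nat) (a : nat -> R) n := (P n)%:R * a n.

(** * Coefficients of a symmetric basis *)

Section SymmetricBasis.
Variables (R : realType) (X : completeNormedModType R) (x : nat -> X).
Hypothesis bx : schauder_basis x.
Hypothesis sx : forall p : nat -> nat, bijective p -> equivalent_seq (x \o p) x.

Local Notation S a := (series (fun n => a n *: x n)).

(** With [q] the inverse of [p], symmetry makes the series of the
    [a k *: x (q k)] converge, and its sum has coordinates [a \o p]. *)
Lemma coef_perm a p : bijective p -> coef x a -> coef x (a \o p).
Proof.
move=> [q pq qp] ca; have bq : bijective q by exists p.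
rewrite (_ : a \o p = spread q a).
  by apply: (coef_spread_of_cvg bx); [exact: bij_inj | rewrite -(sx bq) in ca].
by apply/funext => m; rewrite /= -{2}[m]pq spreadE//; exact: bij_inj.
Qed.

(** A symmetric basis is unconditional. *)
Lemma cvg_rearranged a p : bijective p -> coef x a ->
  cvgn (series (fun n => a (p n) *: x (p n))).
Proof. by move=> bp /(coef_perm bp); rewrite -(sx bp). Qed.

(** Gliding hump: if subsums of the tails stayed large, consecutive blocks
    [[M j, M j.+1)] would each contain a subset with a large sum. Listing that
    subset first within its block is a rearrangement whose partial sums are not
    Cauchy, against [cvg_rearranged]. *)
Lemma coef_subsum_small a e : coef x a -> 0 < e -> exists N,
  forall (T : pred nat) n, (N <= n)%N ->
    `|\sum_(N <= k < n | T k) a k *: x k| <= e.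
Proof.
move=> ca e0; apply: contrapT => nN.
have /choice[f Pf] : forall N, exists Tn : pred nat * nat,
    (N <= Tn.2)%N /\ e < `|\sum_(N <= k < Tn.2 | Tn.1 k) a k *: x k|.
  move=> N; apply: contrapT => nTn; apply: nN; exists N => T n Nn.
  by rewrite leNgt; apply/negP => eT; apply: nTn; exists (T, n).
have lef N : (N < (f N).2)%N.
  have [Nf ef] := Pf N; rewrite ltn_neqAle Nf andbT; apply/eqP => Nf'.
  by move: ef; rewrite -Nf' big_geq// normr0 ltNge ltW.
(* Each block ends where the subset chosen for its left end stops. *)
pose M j := iter j (fun N => (f N).2) 0%N; pose T j := (f (M j)).1.
pose s j := seq.filter (T j) (index_iota (M j) (M j.+1)) ++
            seq.filter (predC (T j)) (index_iota (M j) (M j.+1)).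
have Mlt j : (M j < M j.+1)%N by exact: lef.
have jM j : (j <= M j)%N.
  by elim: j => // j IHj; rewrite (leq_ltn_trans IHj).
have [//|j|p bp ps] := @block_permutation M s _ Mlt.
  by rewrite perm_filterC.
have /cvgn_cauchyP/(_ (e / 2))[|N HN] := cvg_rearranged bp ca.
  by rewrite divr_gt0.
pose l := count (T N) (index_iota (M N) (M N.+1)).
have lM : (M N + l <= M N.+1)%N.
  by rewrite -(subnKC (ltnW (Mlt N))) leq_add2l (leq_trans (count_size _ _))// size_iota.
have [_] := Pf (M N); rewrite -/(T N) -[(f (M N)).2]/(M N.+1).
have -> : \sum_(M N <= k < M N.+1 | T N k) a k *: x k =
          \sum_(M N <= k < M N + l) a (p k) *: x (p k).
  rewrite -big_filter -[RHS](big_map p predT (fun k => a k *: x k)).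
  congr (\big[_/_]_(_ <- _) _).
  have /(congr1 (take l)) := ps N.
  rewrite take_size_cat ?size_filter// -map_take => <-; congr map.
  by rewrite /index_iota take_iota addKn (minn_idPl _)// -(leq_add2l (M N)) subnKC// ltnW.
have h n : (N <= n)%N -> `|series (fun n => a (p n) *: x (p n)) n -
    series (fun n => a (p n) *: x (p n)) N| < e / 2 by exact: HN.
rewrite -sub_series_geq ?leq_addr//.
rewrite -(subrKA (series (fun n => a (p n) *: x (p n)) N)) ltNge ltW//.
rewrite (le_lt_trans (ler_normD _ _))// [ltRHS]splitr ltrD ?h//.
  by rewrite (leq_trans (jM N))// leq_addr.
by rewrite distrC h.
Qed.

(** The subsums bounded in [coef_subsum_small] are the vertices needed by
    [norm_convex_subsums]. *)
Lemma coef_solid a t : (forall n, 0 <= t n <= 1) -> coef x a ->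
  coef x (fun n => t n * a n).
Proof.
move=> t01 ca; apply/cvgn_cauchyP => e e0.
have [|N HN] := @coef_subsum_small a (e / 2) ca; first by rewrite divr_gt0.
exists N => n Nn; rewrite sub_series_geq//.
apply: (@le_lt_trans _ _ (e / 2)); last by rewrite ltr_pdivrMr// ltr_pMr// ltr1n.
have := @norm_convex_subsums _ _ (fun k => a k *: x k) t (e / 2) N (n - N) t01 0.
rewrite subnKC// add0r; under eq_bigr do rewrite scalerA.
apply=> T; rewrite add0r; have := HN T n Nn.
rewrite big_mkcond; congr (`|_| <= _); apply: eq_bigr => k _.
by case: (T k); rewrite ?scale1r ?scale0r.
Qed.

Lemma coef_cutoff a P : coef x a -> coef x (cutoff P a).
Proof.
by apply: coef_solid => // n; rewrite ler0n lern1 leq_b1.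
Qed.

Lemma spread_cutoff P i (a : nat -> R) : spread i (cutoff P a) =
  cutoff (fun m => P (pinv setT i m)) (spread i a).
Proof.
by apply/funext => m; rewrite /spread /patch /cutoff; case: ifP; rewrite ?mulr0.
Qed.

(** When [a] is cut off to a set with infinite complement, spreading it is a
    permutation, namely the one of [extend_partial_inverse]. *)
Lemma coef_spread_cutoff a i P : injective i -> infinite_set [set n | ~~ P n] ->
  coef x (spread i (cutoff P a)) <-> coef x (cutoff P a).
Proof.
move=> ii infP; have [p bp [pi pC]] := extend_partial_inverse ii infP.
have E : spread i (cutoff P a) = cutoff P a \o p.
  apply/funext => m; have [[n Pn <-]|nP] := pselect (exists2 n, P n & i n = m).
    by rewrite spreadE//= pi.
  rewrite /= {2}/cutoff (negbTE (pC m _)) ?mul0r; last first.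
    by move=> n Pn nm; apply: nP; exists n.
  have [[n nm]|nm] := pselect (exists n, i n = m); last first.
    by rewrite spread_out// => n h; apply: nm; exists n.
  rewrite -nm spreadE// /cutoff; case: (boolP (P n)) => [Pn|]; last by rewrite mul0r.
  by exfalso; apply: nP; exists n.
rewrite E; split=> [|c]; last exact: coef_perm.
have [q pq qp] := bp; move=> /(coef_perm (Bijective qp pq)).
by rewrite -compA (_ : p \o q = id)//; apply/funext.
Qed.

(** A sequence without zeros, spread along an [i] that is not onto, acquires
    zeros, so no permutation of entries does it. On the even and on the odd
    entries separately one does, and [coef_solid] allows to split a sequence
    so. *)
Lemma coef_spread a i : injective i -> coef x (spread i a) <-> coef x a.
Proof.
move=> ii.
have inf_even : infinite_set [set n | ~~ odd n].
  apply: sub_infinite_set (infinite_image_inj double_inj).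
  by move=> _ [n _ <-] /=; rewrite odd_double.
have inf_odd : infinite_set [set n | ~~ ~~ odd n].
  apply: sub_infinite_set (infinite_image_inj (inj_comp succn_inj double_inj)).
  by move=> _ [n _ <-] /=; rewrite odd_double.
have split_odd b : coef x b <->
    coef x (cutoff odd b) /\ coef x (cutoff (fun n => ~~ odd n) b).
  split=> [cb|[co ce]]; first by split; exact: coef_cutoff.
  rewrite (_ : b = fun n => cutoff odd b n + cutoff (fun n => ~~ odd n) b n).
    exact: (coef_add co ce).
  apply/funext => n; rewrite /cutoff.
  by case: (odd n); rewrite !(mul0r, mul1r, addr0, add0r).
rewrite (split_odd a) -!(coef_spread_cutoff a ii)// !spread_cutoff.
split=> [ca|[co ce]]; first by split; exact: coef_cutoff.
set P := fun m => odd (pinv setT i m).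
rewrite (_ : spread i a = fun n => cutoff P (spread i a) n +
  cutoff (fun m => ~~ P m) (spread i a) n); first exact: (coef_add co ce).
apply/funext => n; rewrite /cutoff.
by case: (P n); rewrite !(mul0r, mul1r, addr0, add0r).
Qed.

(** The entries selected by [i], put back in place, form a cutoff of [a]. *)
Lemma coef_comp_inj a i : injective i -> coef x a -> coef x (a \o i).
Proof.
move=> ii ca; apply/(coef_spread _ ii).
rewrite (_ : spread i _ = cutoff (fun m => m \in range i) a); first exact: coef_cutoff.
apply/funext => m; have [[n <-]|nm] := pselect (exists n, i n = m).
  by rewrite spreadE// /cutoff mem_set ?mul1r//; exists n.
rewrite spread_out; last by move=> n h; apply: nm; exists n.
by rewrite /cutoff memNset ?mul0r// => -[n _ h]; apply: nm; exists n.
Qed.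

(** Otherwise [x] tends to zero along a subsequence, since the terms
    [a n *: x n] do. A sparser subsequence [x \o i] makes the series of the
    [c k *: x (i k)] converge absolutely for [c k := `|x k|^-1]; then [c] is in
    [coef x] by [coef_spread], although the [c k *: x k] have norm one. *)
Lemma coef_null a e : coef x a -> 0 < e ->
  exists N, forall n, (N <= n)%N -> `|a n| < e.
Proof.
move=> ca e0; apply: contrapT => nN.
have inf_a N : exists2 m, (N <= m)%N & e <= `|a m|.
  apply: contrapT => nm; apply: nN; exists N => n Nn; rewrite ltNge.
  by apply/negP => ea; apply: nm; exists n.
have /choice[g gP] : forall kN : nat * nat, exists m,
    (kN.2 <= m)%N /\ `|x m| <= `|x kN.1| * 2^-1 ^+ kN.1.
  move=> [k N] /=; set d := _ * _; have d0 : 0 < d.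
    by rewrite mulr_gt0 ?exprn_gt0 ?invr_gt0// normr_gt0 basis_neq0.
  have [|N' HN'] := (cvg_seqP _ _).1 (cvg_series_cvg_0 ca) (e * d).
    exact: mulr_gt0.
  have [m Nm ea] := inf_a (maxn N N'); exists m; split.
    by rewrite (leq_trans _ Nm)// leq_maxl.
  have := HN' m (leq_trans (leq_maxr _ _) Nm); rewrite subr0 normrZ => h.
  rewrite -(ler_pM2l e0) (le_trans _ (ltW h))// ler_wpM2r//.
pose fix i k := if k is k'.+1 then g (k, (i k').+1) else g (0, 0)%N.
have iS k : (i k < i k.+1)%N by have [] := gP (k.+1, (i k).+1).
have ii : injective i by exact: incn_inj (leq_mono (homo_ltn ltn_trans iS)).
have ix k : `|x (i k)| <= `|x k| * 2^-1 ^+ k.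
  by case: k => [|k]; [have [] := gP (0, 0)%N | have [] := gP (k.+1, (i k).+1)].
pose c k := `|x k|^-1.
have : coef x (spread i c).
  apply: (coef_spread_of_cvg bx) => //; apply: normed_cvg.
  apply: (@series_le_cvg _ _ (geometric 1 2^-1)).
  - by move=> n; exact: normr_ge0.
  - by move=> n; exact: geometric_ge0.
  - move=> n; rewrite /= normrZ normfV normr_id mul1r ler_pdivrMl ?ix//.
    by rewrite normr_gt0 basis_neq0.
  - by apply: is_cvg_geometric_series; rewrite gtr0_norm ?invr_gt0// invf_lt1// ltr1n.
move=> /(coef_spread c ii) cc.
have [//|N HN] := (cvg_seqP _ _).1 (cvg_series_cvg_0 cc) 1.
have := HN N (leqnn N).
by rewrite subr0 normrZ normfV normr_id mulVf ?ltxx// normr_eq0 basis_neq0.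
Qed.

Lemma coef_finite_sum (F : nat -> nat -> R) J : (forall j, coef x (F j)) ->
  coef x (fun n => \sum_(0 <= j < J) F j n).
Proof.
move=> cF; elim: J => [|J IHJ].
  rewrite (_ : (fun _ => _) = cutoff pred0 (F 0%N)); first exact: coef_cutoff.
  by apply/funext => n; rewrite /cutoff big_geq// mul0r.
rewrite (_ : (fun _ => _) = fun n => \sum_(0 <= j < J) F j n + F J n).
  exact: coef_add.
by apply/funext => n; rewrite big_nat_recr.
Qed.

End SymmetricBasis.

(** * Continuity and Borel maps *)

Lemma continuous_borel (Z W : topologicalType) (f : Z -> W) :
  continuous f -> borel_fun f.
Proof.
move=> /continuousP cf B sB; rewrite -[_ @^-1` _]setTI.
have := sigma_algebra_image f (smallest_sigma_algebra [set: Z] (@open Z)).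
move=> /smallest_sub sub; apply: (sub _ _ B sB) => U oU.
by rewrite /image_set_system /= setTI; apply: sub_gen_smallest; exact: cf.
Qed.

Lemma continuous_into_product (Z : topologicalType) (R : realType) (f : Z -> RN R) :
  (forall n, continuous (fun z => f z n)) -> continuous f.
Proof.
move=> cf z; apply/cvg_sup => n.
by apply: (@continuous_comp_initial _ _ _ (fun a : nat -> R => a n) f (cf n)).
Qed.

Lemma continuous_coordinate (R : realType) n : continuous (fun a : RN R => a n).
Proof. exact: (@proj_continuous nat (fun _ => (R : topologicalType)) n). Qed.

(** * Clipping to the unit interval *)

Section Clip.
Variable R : realType.
Implicit Types r s : R.

Definition clip r : R := Num.max 0 (Num.min 1 r).

Lemma clipP r : [\/ r <= 0 /\ clip r = 0, 0 <= r <= 1 /\ clip r = r |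
                    1 <= r /\ clip r = 1].
Proof.
rewrite /clip; have [r0|r0] := leP r 0.
  by constructor 1; rewrite min_r ?max_l// (le_trans r0).
have [r1|r1] := leP r 1; last first.
  by constructor 3; rewrite max_r// ltW.
by constructor 2; rewrite max_r// ltW.
Qed.

Lemma clip_itv r : 0 <= clip r <= 1.
Proof.
by have [[_ ->]|[r01 ->]|[_ ->]] := clipP r; rewrite ?r01// ?lexx ler01.
Qed.

Lemma clip_le0 r : r <= 0 -> clip r = 0.
Proof. by have [[_ ->]|[/andP[? ?] ->]|[? ->]] := clipP r; lra. Qed.

Lemma clip_ge1 r : 1 <= r -> clip r = 1.
Proof. by have [[? ->]|[/andP[? ?] ->]|[_ ->]] := clipP r; lra. Qed.

Lemma clip_sub r s : exists2 t, 0 <= t <= 1 & clip r - clip s = t * (r - s).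
Proof.
have [->|rs] := eqVneq r s; first by exists 0; rewrite ?lexx ?ler01// !subrr mulr0.
exists ((clip r - clip s) / (r - s)); last by rewrite divfK// subr_eq0.
wlog {rs} rs : r s / s < r.
  move=> H; case: (ltgtP r s) rs => // rs _; last exact: H.
  by rewrite -mulrNN -invrN !opprB; exact: H.
rewrite ler_pdivlMr ?subr_gt0// ler_pdivrMr ?subr_gt0// mul0r mul1r.
have [[? ->]|[/andP[? ?] ->]|[? ->]] := clipP r;
  have [[? ->]|[/andP[? ?] ->]|[? ->]] := clipP s; apply/andP; split; lra.
Qed.

Lemma sum_clip r J : 0 <= r <= J%:R -> \sum_(0 <= j < J) clip (r - j%:R) = r.
Proof.
elim: J r => [|J IHJ] r /andP[r0]; first by rewrite big_geq// => ?; lra.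
rewrite -[J.+1%:R]natr1 => rJ; rewrite big_nat_recr//=.
have [rJ'|Jr] := leP r J%:R.
  by rewrite IHJ ?r0// clip_le0 ?addr0// subr_le0.
have -> : \sum_(0 <= j < J) clip (r - j%:R) = J%:R.
  rewrite -[RHS](IHJ J%:R) ?ler0n ?lexx//; apply: eq_big_nat => j /andP[_ jJ].
  have : (j.+1%:R : R) <= J%:R by rewrite ler_nat.
  by rewrite -natr1 => ?; rewrite !clip_ge1//; lra.
by have [[? ->]|[? ->]|[? ->]] := clipP (r - J%:R); lra.
Qed.

Lemma continuous_clip : continuous clip.
Proof.
move=> r; apply: (@continuous_max _ _ (fun=> 0) (fun r => Num.min 1 r)).
  exact: cvg_cst.
by apply: (@continuous_min _ _ (fun=> 1) id); [exact: cvg_cst|exact: cvg_id].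
Qed.

End Clip.

(** * Slicing a sequence of reals at the integers *)

Lemma bounded_of_tail (R : realType) (f : nat -> R) (C : R) N :
  (forall n, (N <= n)%N -> `|f n| < C) -> exists L : nat, forall n, `|f n| <= L%:R.
Proof.
move=> fC; pose B := `|C| + \sum_(k < N) `|f k|.
exists (Num.truncn B).+1 => n; rewrite (@le_trans _ _ B)//; last first.
  exact/ltW/truncnS_gt.
have [nN|Nn] := ltnP n N.
  rewrite /B (bigD1 (Ordinal nN))//= addrCA lerDl addr_ge0//.
  exact: sumr_ge0.
rewrite (le_trans (ltW (fC n Nn)))// (le_trans (ler_norm C))// lerDl.
exact: sumr_ge0.
Qed.

Section Reduction.
Variable R : realType.
Implicit Types a b : RN R.

(** The slice of [a n] at height [k] is the length of the part of the interval
    from [k] to [k + 1] that lies below [a n]. The slices of all entries are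
    listed through the encoding of pairs [(n, k)], with zeros at the indices
    that encode no pair. *)
Definition slices a : RN R := fun m =>
  if @pickle_inv (nat * int)%type m is Some (n, k) then clip (a n - k%:~R) else 0.

Lemma slices_cube a : hilbert_cube R (slices a).
Proof.
move=> m; rewrite /slices; case: pickle_inv => [[n k]|]; first exact: clip_itv.
by rewrite lexx ler01.
Qed.

Lemma continuous_slices : continuous slices.
Proof.
apply: continuous_into_product => m; rewrite /slices.
case: (@pickle_inv (nat * int)%type m) => [[n k]|]; last first.
  exact: cst_continuous.
move=> a; apply: (@continuous_comp _ _ _ (fun b : RN R => b n - k%:~R) (@clip R)).
  apply: (@cvgB _ R^o _ (nbhs a) _ (fun b : RN R => b n) (fun=> k%:~R)).
    exact: continuous_coordinate.
  exact: cvg_cst.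
exact: continuous_clip.
Qed.

Definition slices_in_cube a : hilbert_cube R := SigSub (mem_set (slices_cube a)).

Lemma continuous_slices_in_cube : continuous slices_in_cube.
Proof. by apply: continuous_comp_initial; exact: continuous_slices. Qed.

Lemma slicesE a n k : slices a (pickle (n, k)) = clip (a n - k%:~R).
Proof. by rewrite /slices pickleK_inv. Qed.

(** The lowest height at which the slices of [a n] and [b n] can differ. *)
Definition base a b n : int := Num.floor (Num.min (a n) (b n)).

Definition slot a b j n : nat := pickle (n, base a b n + j%:Z).

Section Pair.
Variables a b : RN R.

Local Notation D := (fun m => slices a m - slices b m).
Local Notation base := (base a b).
Local Notation slot := (slot a b).

Lemma slot_inj j : injective (slot j).
Proof. by move=> n n' /(pcan_inj (@pickleK_inv _)) []. Qed.

Lemma base_le n : (base n)%:~R <= a n /\ (base n)%:~R <= b n.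
Proof.
by split; rewrite (le_trans (floor_le _))// ge_min lexx ?orbT.
Qed.

Lemma lt_base n (L : R) : `|a n - b n| <= L ->
  a n < (base n)%:~R + 1 + L /\ b n < (base n)%:~R + 1 + L.
Proof.
have := floorD1_gt (Num.min (a n) (b n)); rewrite -/(base n) intrD => h.
rewrite ler_norml => /andP[h1 h2]; move: h.
by have [?|?] := leP (a n) (b n) => ?; split; lra.
Qed.

Lemma slice_multiplier j : exists2 t, forall n, 0 <= t n <= 1 &
  D \o slot j = fun n => t n * (a n - b n).
Proof.
have /choice[t Ht] : forall n, exists t, 0 <= t <= 1 /\ D (slot j n) = t * (a n - b n).
  move=> n; rewrite /slot !slicesE.
  have [t t01 tE] := clip_sub (a n - (base n + j%:Z)%:~R) (b n - (base n + j%:Z)%:~R).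
  by exists t; split=> //; rewrite tE; congr (_ * _); ring.
by exists t => [n|]; [case: (Ht n)|apply/funext => n; case: (Ht n)].
Qed.

(** At distance at least two, the interval one level above the base lies
    entirely between [a n] and [b n]. *)
Lemma slot1_jump n : 2 <= `|a n - b n| -> `|D (slot 1 n)| = 1.
Proof.
rewrite /slot !slicesE intrD => ab.
have [la lb] := base_le n.
have := floorD1_gt (Num.min (a n) (b n)); rewrite -/(base n) intrD.
set f := (base n)%:~R in la lb *; move: ab.
have [h|h] := leP (a n) (b n).
  rewrite ler0_norm ?subr_le0// => ab fa.
  by rewrite clip_le0 ?clip_ge1 ?sub0r ?normrN1//; lra.
rewrite gtr0_norm ?subr_gt0// => ab fb.
by rewrite clip_ge1 ?clip_le0 ?subr0 ?normr1//; lra.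
Qed.

Variable L : nat.
Hypothesis dL : forall n, `|a n - b n| <= L%:R.

(** As [base n] is below both entries and both are less than [L.+1] above it,
    the [L.+1] slices from the base on recover them. *)
Lemma sum_slices : (fun n => a n - b n) = fun n => \sum_(0 <= j < L.+1) (D \o slot j) n.
Proof.
apply/funext => n; have [la lb] := base_le n; have [ua ub] := lt_base (dL n).
under eq_bigr do rewrite /= /slot !slicesE !intrD !opprD !addrA.
rewrite sumrB !sum_clip; first by ring.
  by rewrite -natr1; apply/andP; split; lra.
by rewrite -natr1; apply/andP; split; lra.
Qed.

(** Below the base both slices are full, and from height [L.+1] above it both
    are empty, so all differences of slices sit in the slots of the [L.+1]
    levels in between. *)
Lemma slices_decomposition : D =
  fun m => \sum_(0 <= j < L.+1) spread (slot j) (D \o slot j) m.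
Proof.
apply/funext => m.
have [[j [jL [n jm]]]|nj] := pselect (exists j, (j < L.+1)%N /\ exists n, slot j n = m).
  rewrite big_mkord (bigD1 (Ordinal jL))//= -jm spreadE//; last exact: slot_inj.
  rewrite big1 ?addr0// => i ij; apply: spread_out => n'.
  move=> /(pcan_inj (@pickleK_inv _)) [-> /addrI [ij']].
  by rewrite -val_eqE /= ij' eqxx in ij.
rewrite big1_seq; last first.
  move=> j /andP[_]; rewrite mem_index_iota /= => jL; apply: spread_out => n nm.
  by apply: nj; exists j; split=> //; exists n.
rewrite /slices; case mE: pickle_inv => [[n k]|]; last by rewrite subrr.
have {}mE : m = pickle (n, k).
  by have := @pickle_invK (nat * int)%type m; rewrite mE.
have [la lb] := base_le n; have [ua ub] := lt_base (dL n).
have [kb|bk] := ltP k (base n).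
  have : k%:~R + 1 <= (base n)%:~R :> R by rewrite -(intrD R k 1) ler_int lezD1.
  by move=> ?; rewrite !clip_ge1 ?subrr//; lra.
have [j kE] : exists j : nat, k = base n + j%:Z.
  by exists `|k - base n|%N; rewrite gez0_abs ?subr_ge0// addrCA subrr addr0.
have Lj : (L.+1 <= j)%N.
  rewrite leqNgt; apply/negP => jL; apply: nj; exists j; split=> //.
  by exists n; rewrite mE kE.
have : (L.+1%:R : R) <= j%:R by rewrite ler_nat.
rewrite -natr1 => ?; rewrite kE intrD -pmulrn.
by rewrite !clip_le0 ?subrr//; lra.
Qed.

End Pair.

End Reduction.

(** * The reduction *)

Theorem theorem1p2 (R : realType) (X : completeNormedModType R) (x : nat -> X)
    (hx : symmetric_basis x) :
  borel_bireducible (E_rel x) (E_cube x).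
Proof.
have [bx sx] := hx; split; last first.
  exists set_val; last by [].
  apply: continuous_borel.
  exact: (@initial_continuous (hilbert_cube R) (RN R) set_val).
exists (@slices_in_cube R).
  apply: continuous_borel.
  exact: continuous_slices_in_cube.
move=> a b; rewrite /E_cube /E_rel.
have -> : (fun m => set_val (slices_in_cube a) m - set_val (slices_in_cube b) m) =
    fun m => slices a m - slices b m by [].
split=> [cd|cD].
  have [N dN] := coef_null bx sx cd ltr01; have [L dL] := bounded_of_tail dN.
  rewrite (slices_decomposition dL); apply: (coef_finite_sum bx sx) => // j.
  apply/(coef_spread bx sx _ (@slot_inj R a b j)).
  by have [t t01 ->] := slice_multiplier a b j; exact: (coef_solid bx sx).
have cj j := coef_comp_inj bx sx (@slot_inj R a b j) cD.
have [N DN] := coef_null bx sx (cj 1%N) ltr01.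
have [|L dL] := @bounded_of_tail R (fun n => a n - b n) 2 N.
  move=> n /DN; rewrite ltNge => D1; rewrite ltNge; apply: contra D1.
  by move=> /slot1_jump /= ->.
by rewrite (sum_slices dL); exact: (coef_finite_sum bx sx).
Qed.
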